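(* Fix $b(x)\in\mathbb{Z}[x]$ and $a^{(1)}(x)\in\mathbb{Z}[x]$ with $\deg b=2\deg a^{(1)}=2d$, $d\ge1$, and for $k\in\mathbb{Z}$ let $a^{(k)}=k\,a^{(1)}$. Suppose that for all (sufficiently large) $k$, $\mathrm{PCF}[a^{(k)}_n,b_n]$ (with $a^{(k)}_n=a^{(k)}(n)$, $b_n=b(n)$) satisfies the hypotheses under which its effective irrationality measure is $\delta_k=\frac{\ln\alpha_k-\ln|B|+\ln\lambda_k}{\ln\alpha_k-\ln\lambda_k}$, namely: it has factorial reduction ($\lambda_k>0$) and $B>-A_k^2/4$, where $A_k$ is the leading coefficient of $a^{(k)}$, $B$ that of $b$, $\alpha_k$ the root of larger absolute value of $\alpha^2=A_k\alpha+B$, and $\ln\lambda_k=\limsup_n\frac1n\ln(\gcd(p^{(k)}_n,q^{(k)}_n)/n!^{d})$. Assume moreover that $(\ln\lambda_k)_k$ is bounded. Then $\lim_{k\to\infty}\delta_k=1$; in particular, for all sufficiently large $k$, $\delta_k>0$ and the limit of $\mathrm{PCF}[a^{(k)}_n,b_n]$ is irrational.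
   Context: A polynomial continued fraction is $\mathrm{PCF}[a_n,b_n]=a_0+\cfrac{b_1}{a_1+\cfrac{b_2}{a_2+\cdots}}$; its convergents $p_n/q_n$ satisfy $u_n=a_nu_{n-1}+b_nu_{n-2}$ with $p_{-1}=1,p_0=a_0,q_{-1}=0,q_0=1$. The effective irrationality measure $\delta$ of $p_n/q_n\to L$ is the largest $\delta$ with $|L-p_n/q_n|<(q_n/\gcd(p_n,q_n))^{-(1+\delta)}$ for almost all $n$; $\delta>0$ implies $L$ is irrational. Factorial reduction means $\limsup_n\frac1n\ln(\gcd(p_n,q_n)/n!^{\deg a})>-\infty$. *)

(* Defs.v *)
From HB Require Import structures.
From mathcomp Require Import all_boot all_order all_algebra.
From mathcomp Require Import all_classical all_reals all_analysis.
Set Implicit Arguments.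
Unset Strict Implicit.
Unset Printing Implicit Defensive.
Import Order.TTheory GRing.Theory Num.Theory.
Import numFieldNormedType.Exports.

Local Open Scope ring_scope.

(* The pair (u_(n-1), u_n), given the initial pair (u_(-1), u_0). *)
Fixpoint pcf_rec (a b : {poly int}) (init : int * int) (n : nat) : int * int :=
  if n is m.+1 then
    let: (x, y) := pcf_rec a b init m in
    (y, a.[n%:Z] * y + b.[n%:Z] * x)
  else init.

Definition pcf_num (a b : {poly int}) (n : nat) : int :=
  (pcf_rec a b (1, a.[0]) n).2.

Definition pcf_den (a b : {poly int}) (n : nat) : int :=
  (pcf_rec a b (0, 1) n).2.

Definition pcf_convergent (R : realType) (a b : {poly int}) (n : nat) : R :=
  (pcf_num a b n)%:~R / (pcf_den a b n)%:~R.

(* The limsup is taken in the extended reals, with [lne 0 = -oo]; a vanishing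
   gcd (p_n = q_n = 0) hence contributes -oo and not the junk value [ln 0 = 0]. *)
Definition gcd_rate (R : realType) (d : nat) (a b : {poly int}) : \bar R :=
  limn_esup (fun n : nat =>
    ((n%:R^-1)%:E *
     lne (((gcdz (pcf_num a b n) (pcf_den a b n))%:~R / (n`!)%:R ^+ d)%:E))%E).

Definition factorial_reduction (R : realType) (a b : {poly int}) : Prop :=
  (-oo < gcd_rate R (size a).-1 a b)%E.

Definition larger_root (R : realType) (A B : int) (alpha : R) : Prop :=
  alpha ^+ 2 = A%:~R * alpha + B%:~R /\
  forall beta : R, beta ^+ 2 = A%:~R * beta + B%:~R -> `|beta| <= `|alpha|.

(* The larger root has the sign of the leading coefficient of a, which may be
   negative: the formula reads ln |alpha|. *)
Definition pcf_delta (R : realType) (B : int) (alpha lambda : R) : R :=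
  (ln `|alpha| - ln `|B%:~R| + ln lambda) / (ln `|alpha| - ln lambda).

(* Main.v *)
(* Write a_n = k a1(n).  For large k one has 8 |b_(n+1)| <= |a_n a_(n+1)| from an
   index N independent of k on, so a solution u of the recurrence is either
   subdominant, |a_(n+2) u_(n+1)| <= 2 |b_(n+2) u_n| for all n >= N, or eventually
   dominant, |a_(n+1) u_n| <= 2 |u_(n+1)|.  Up to constants, dominant solutions
   grow at least like (k/4)^n n!^d and subdominant ones at most like
   (C/k)^n n!^d.

   The denominators q_n(k) are dominant for all large k.  Otherwise they are
   subdominant for arbitrarily large k, so that the degree in k of the polynomial
   q_n(k) drops strictly with n >= N, and q_n vanishes identically for large n.
   Then gcd(p_n, q_n) = |p_n| either vanishes eventually (if p is subdominant for
   arbitrarily large k too) or grows like (k/4)^n n!^d, and both contradict the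
   bounds on ln lambda_k.

   When q is dominant, p_n/q_n converges to some L and L q_n - p_n is at most of
   size (C/k)^n n!^d.  If L = P/Q, the integer P q_n - Q p_n is divisible by
   gcd(p_n, q_n) and smaller than it for infinitely many n, hence zero infinitely
   often.  As it solves the recurrence and is not dominant, it is eventually zero,
   so q_n divides Q gcd(p_n, q_n): the gcd would again be too large. *)

Require Import Defs.
From HB Require Import structures.
From mathcomp Require Import all_boot all_order all_algebra.
From mathcomp Require Import all_classical all_reals all_analysis.
From mathcomp Require Import ring lra zify.
Set Implicit Arguments.
Unset Strict Implicit.
Unset Printing Implicit Defensive.
Import Order.TTheory GRing.Theory Num.Theory.
Import numFieldNormedType.Exports.

Local Open Scope classical_set_scope.
Local Open Scope ring_scope.

(** * Values of integer polynomials at large integers *)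

Lemma normr_horner_le (p : {poly int}) (x : int) : 1 <= x ->
  `|p.[x]| <= (\sum_(i < size p) `|p`_i|) * x ^+ (size p).-1.
Proof.
move=> x1; rewrite horner_coef (le_trans (ler_norm_sum _ _ _))// mulr_suml.
apply: ler_sum => i _; rewrite normrM normrX (ger0_norm (le_trans ler01 x1)).
by rewrite ler_wpM2l// ler_weXn2l// -ltnS prednK// (leq_ltn_trans _ (ltn_ord i)).
Qed.

(** A nonzero integer leading coefficient has absolute value at least 1, and the lower terms total
    at most half of [n ^ s] once [n] is twice the sum of their absolute coefficients. *)
Lemma exp_le_normr_horner (p : {poly int}) : p != 0 ->
  exists X : nat, forall n : nat, (X <= n)%N ->
    n%:Z ^+ (size p).-1 <= 2 * `|p.[n%:Z]|.
Proof.
move=> p0; set s := (size p).-1.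
have sE : size p = s.+1 by rewrite prednK// size_poly_gt0.
have lc1 : 1 <= `|p`_s|.
  by have : p`_s != 0; [rewrite -lead_coefE lead_coef_eq0 | lia].
pose D : int := \sum_(i < s) `|p`_i|.
have D0 : 0 <= D by exact: sumr_ge0.
exists (2 * `|D| + 1)%N => n nX.
have n1 : 1 <= n%:Z by lia.
have nD : 2 * D <= n%:Z by lia.
rewrite horner_coef sE big_ord_recr/=.
set S := \sum_(i < s) _.
have SD : 2 * `|S| <= n%:Z ^+ s.
  rewrite /S /D in nD *; case: (s) nD => [|t] nD.
    by rewrite big_ord0 normr0 mulr0 expr0.
  rewrite exprS (le_trans _ (ler_wpM2r _ nD)) ?exprn_ge0 ?(le_trans _ n1)//.
  rewrite -mulrA ler_wpM2l// (le_trans (ler_norm_sum _ _ _))// mulr_suml.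
  apply: ler_sum => i _; rewrite normrM normrX (ger0_norm (le_trans ler01 n1)).
  by rewrite ler_wpM2l// ler_weXn2l// -ltnS.
have := lerB_dist (p`_s * n%:Z ^+ s) (- S).
rewrite opprK normrN [_ + S]addrC normrM normrX (ger0_norm (le_trans ler01 n1)).
have : n%:Z ^+ s <= `|p`_s| * n%:Z ^+ s.
  by rewrite ler_peMl// exprn_ge0// (le_trans _ n1).
lra.
Qed.

(** Otherwise [|Q(k)|] is at most a constant times [|P(k)|] for large [k], and the extra factor [k]
    outgrows every constant. *)
Lemma size_lt_of_small_values (P Q : {poly int}) (C : int) :
  (forall K : nat, exists2 k : nat, (K <= k)%N &
     k%:Z * `|P.[k%:Z]| <= C * `|Q.[k%:Z]|) ->
  P != 0 -> (size P < size Q)%N.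
Proof.
move=> small P0; rewrite ltnNge; apply/negP => sQP.
have [X lowP] := exp_le_normr_horner P0.
pose D : int := \sum_(i < size Q) `|Q`_i|.
have D0 : 0 <= D by exact: sumr_ge0.
have [k kX kPQ] := small (X + absz (2 * `|C| * D)%R + 1)%N.
have k1 : 1 <= k%:Z by lia.
have k0 : 0 <= k%:Z by lia.
have kD : 2 * `|C| * D < k%:Z by lia.
have PL := lowP k ltac:(lia).
have QU := normr_horner_le Q k1; rewrite -/D in QU.
have QP : k%:Z ^+ (size Q).-1 <= k%:Z ^+ (size P).-1.
  by rewrite ler_weXn2l// -!subn1 leq_sub2r.
set xP := k%:Z ^+ (size P).-1 in PL QP *.
have xP0 : 0 < xP by rewrite exprn_gt0//; lia.
have QD : `|Q.[k%:Z]| <= D * xP by rewrite (le_trans QU)// ler_wpM2l.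
have CQ : C * `|Q.[k%:Z]| <= `|C| * (D * xP).
  by rewrite (le_trans (ler_wpM2r _ (ler_norm C)))// ler_wpM2l.
have kP : k%:Z * xP <= k%:Z * (2 * `|P.[k%:Z]|) by rewrite ler_wpM2l.
have : 2 * `|C| * D * xP < k%:Z * xP by rewrite ltr_pM2r.
lra.
Qed.

(** Each step from [N] on lowers the degree, so [size (U N)] steps suffice. The constant [C n] may
    depend on [n] but not on [k]. *)
Lemma eventually_zero_of_small_values (U : nat -> {poly int}) (C : nat -> int)
    (N : nat) :
  (forall K : nat, exists2 k : nat, (K <= k)%N & forall n, (N <= n)%N ->
     k%:Z * `|(U n.+1).[k%:Z]| <= C n * `|(U n).[k%:Z]|) ->
  exists n1, forall n, (n1 <= n)%N -> U n = 0.
Proof.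
move=> small.
have step n : (N <= n)%N -> U n.+1 = 0 \/ (size (U n.+1) < size (U n))%N.
  move=> Nn; have [->|U0] := eqVneq (U n.+1) 0; [by left|right].
  apply: (@size_lt_of_small_values _ _ (C n)) U0 => K.
  by have [k Kk /(_ n Nn)] := small K; exists k.
have szU j : (size (U (N + j)%N) <= size (U N) - j)%N.
  elim: j => [|j IH]; first by rewrite addn0 subn0.
  rewrite addnS; have [->|] := step _ (leq_addr j N); first by rewrite size_poly0.
  lia.
exists (N + size (U N))%N => n nN; apply/eqP; rewrite -size_poly_leq0.
by have := szU (n - N)%N; rewrite subnKC; lia.
Qed.

(** * Comparison with the sequences rho^n n!^d *)

(** Monotonicity of [x / F], with no sign condition on [x]: taking [x := - s] turns it into an upper
    bound for [s]. *)
Lemma ratio_nondecreasing (R : realFieldType) (x F : nat -> R) (m : nat) :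
  (forall n, 0 < F n) ->
  (forall n, (m <= n)%N -> F n.+1 * x n <= F n * x n.+1) ->
  forall n, (m <= n)%N -> F n * x m <= F m * x n.
Proof.
move=> F0 Fx n; elim: n => [|n IH]; first by rewrite leqn0 => /eqP->.
rewrite leq_eqVlt => /predU1P[->//|mn].
rewrite -(ler_pM2l (F0 n)) mulrCA (le_trans (ler_wpM2l (ltW (F0 _)) (IH mn)))//.
by rewrite mulrCA [leRHS]mulrCA ler_wpM2l ?Fx// ltW.
Qed.

Definition fact_growth (R : pzRingType) (d : nat) (rho : R) (n : nat) : R :=
  rho ^+ n * n`!%:R ^+ d.

Lemma fact_growth_gt0 (R : realFieldType) d (rho : R) n :
  0 < rho -> 0 < fact_growth d rho n.
Proof. by move=> r0; rewrite mulr_gt0// exprn_gt0// ltr0n fact_gt0. Qed.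

Lemma fact_growthS (R : realFieldType) d (rho : R) n :
  fact_growth d rho n.+1 = rho * n.+1%:R ^+ d * fact_growth d rho n.
Proof. by rewrite /fact_growth exprS factS natrM exprMn; ring. Qed.

Lemma exp2_unbounded (R : realType) (X : R) :
  exists N, forall n, (N <= n)%N -> X < 2 ^+ n.
Proof.
exists (Num.bound `|X|) => n Nn; rewrite (le_lt_trans (ler_norm X))//.
rewrite (lt_le_trans (archi_boundP (normr_ge0 X)))// -natrX ler_nat.
by rewrite (leq_trans Nn)// ltnW// ltn_expl.
Qed.

(** * Dominant and subdominant solutions of the recurrence *)

Definition pcf_solution (R : pzRingType) (a b u : nat -> R) : Prop :=
  forall n, u n.+2 = a n.+2 * u n.+1 + b n.+2 * u n.

(** Nonvanishing is required separately, since the zero solution satisfies the inequality. *)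
Definition dominant (R : numDomainType) (a u : nat -> R) (m : nat) : Prop :=
  forall n, (m <= n)%N -> u n != 0 /\ `|a n.+1| * `|u n| <= 2 * `|u n.+1|.

Definition subdominant (R : numDomainType) (a b u : nat -> R) (N : nat) : Prop :=
  forall n, (N <= n)%N -> `|a n.+2| * `|u n.+1| <= 2 * `|b n.+2| * `|u n|.

Section Recurrence.
Variables (R : realType) (a b : nat -> R) (N : nat).
Hypothesis a_neq0 : forall n, (N <= n)%N -> a n != 0.
Hypothesis ab : forall n, (N <= n)%N -> 8 * `|b n.+1| <= `|a n| * `|a n.+1|.

(** One failure of subdominance propagates forever: the [b]-term is then at most half of the
    [a]-term, which gives the growth of [u], and [ab] restores the same situation at the next
    index. *)
Lemma solution_dichotomy (u : nat -> R) : pcf_solution a b u ->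
  subdominant a b u N \/ exists2 m, (N <= m)%N & dominant a u m.
Proof.
move=> usol; apply/or_asboolP; rewrite -implyNb; apply/implyP => /asboolPn.
move=> /existsNP[n /not_implyP[Nn /negP]]; rewrite -ltNge => big.
pose I n := u n.+1 != 0 /\ 2 * `|b n.+2| * `|u n| <= `|a n.+2| * `|u n.+1|.
have In : I n.
  split; last exact: ltW.
  by apply: contraTneq big => ->; rewrite normr0 mulr0 -leNgt !mulr_ge0.
have grow j : I j -> `|a j.+2| * `|u j.+1| <= 2 * `|u j.+2|.
  move=> [_ Ij]; rewrite usol.
  have := lerB_dist (a j.+2 * u j.+1) (- (b j.+2 * u j)).
  rewrite opprK normrN !normrM; lra.
have step j : (N <= j)%N -> I j -> I j.+1.
  move=> Nj Ij; have gj := grow j Ij; case: Ij => uj0 _.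
  have a0 k : (N <= k)%N -> 0 < `|a k| by move=> /a_neq0; rewrite normr_gt0.
  split.
    rewrite -normr_gt0 -(pmulr_rgt0 _ (ltr0Sn R 1)) (lt_le_trans _ gj)//.
    by rewrite mulr_gt0// ?normr_gt0// -normr_gt0 a0//; lia.
  have h : 8 * `|b j.+3| * `|u j.+1| <= `|a j.+2| * `|a j.+3| * `|u j.+1|.
    by rewrite ler_wpM2r// ab//; lia.
  have : `|a j.+3| * (`|a j.+2| * `|u j.+1|) <= `|a j.+3| * (2 * `|u j.+2|).
    by rewrite ler_wpM2l.
  have : 0 <= `|b j.+3| * `|u j.+1| by rewrite mulr_ge0.
  lra.
apply/asboolP; exists n.+1; first exact: leqW.
have IS k : (n <= k)%N -> I k.
  elim: k => [|k IH]; first by rewrite leqn0 => /eqP <-.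
  rewrite leq_eqVlt => /predU1P[<-//|nk].
  by apply: step (IH nk); rewrite (leq_trans Nn).
case=> // k nk; split; first by have [] := IS k nk.
exact/grow/IS.
Qed.

(** The numerator of the difference of consecutive convergents. *)
Definition casoratian (p q : nat -> R) n := p n.+1 * q n - p n * q n.+1.

Lemma casoratianS (p q : nat -> R) : pcf_solution a b p -> pcf_solution a b q ->
  forall n, casoratian p q n.+1 = - b n.+2 * casoratian p q n.
Proof. by move=> ps qs n; rewrite /casoratian ps qs; ring. Qed.

End Recurrence.

(** * Convergence from geometrically shrinking steps *)

(** The intervals of centre [x n] and radius [2 * e n] are nested; the limit is the supremum of
    their left endpoints. *)
Lemma geometric_steps_cvg (R : realType) (x e : nat -> R) (m : nat) :
  (forall n, (m <= n)%N -> `|x n.+1 - x n| <= e n) ->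
  (forall n, (m <= n)%N -> 2 * e n.+1 <= e n) ->
  exists2 L : R, x @ \oo --> L & forall n, (m <= n)%N -> `|L - x n| <= 2 * e n.
Proof.
move=> xe ee.
have e0 n : (m <= n)%N -> 0 <= e n by move=> /xe; apply: le_trans.
have lo n k : (m <= n)%N -> (n <= k)%N -> x n - 2 * e n <= x k - 2 * e k.
  move=> mn; elim: k => [|k IH]; first by rewrite leqn0 => /eqP->.
  rewrite leq_eqVlt => /predU1P[->//|nk]; have mk := leq_trans mn nk.
  by have := IH nk; have := xe _ mk; have := ee _ mk; rewrite ler_norml; lra.
have hi n k : (m <= n)%N -> (n <= k)%N -> x k + 2 * e k <= x n + 2 * e n.
  move=> mn; elim: k => [|k IH]; first by rewrite leqn0 => /eqP->.
  rewrite leq_eqVlt => /predU1P[->//|nk]; have mk := leq_trans mn nk.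
  by have := IH nk; have := xe _ mk; have := ee _ mk; rewrite ler_norml; lra.
have lohi n k : (m <= n)%N -> (m <= k)%N -> x n - 2 * e n <= x k + 2 * e k.
  move=> mn mk; have [nk|/ltnW kn] := leqP n k.
    by have := lo n k mn nk; have := e0 k mk; lra.
  by have := hi k n mk kn; have := e0 n mn; lra.
pose E := [set x n - 2 * e n | n in [set n | (m <= n)%N]].
have Em : E (x m - 2 * e m) by exists m => /=.
have ubE k : (m <= k)%N -> ubound E (x k + 2 * e k).
  by move=> mk _ [n /= mn <-]; exact: lohi.
have xL n : (m <= n)%N -> `|sup E - x n| <= 2 * e n.
  move=> mn; rewrite ler_distl; apply/andP; split.
    by apply: ub_le_sup; [exists (x m + 2 * e m); exact: ubE|exists n].
  by apply: ge_sup; [exists (x m - 2 * e m)|exact: ubE].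
exists (sup E) => //.
have e2 n : (m <= n)%N -> 2 ^+ n * e n <= 2 ^+ m * e m.
  elim: n => [|n IH]; first by rewrite leqn0 => /eqP->.
  rewrite leq_eqVlt => /predU1P[->//|mn].
  rewrite (le_trans _ (IH mn))// exprSr -mulrA ler_wpM2l ?ee//.
apply/cvgrPdist_lt => eps eps0.
have [K HK] := exp2_unbounded (2 * (2 ^+ m * e m) / eps).
near=> n.
have mn : (m <= n)%N by near: n; exact: nbhs_infty_ge.
have Kn : (K <= n)%N by near: n; exact: nbhs_infty_ge.
rewrite (le_lt_trans (xL n mn))// -(ltr_pM2l (exprn_gt0 n (ltr0Sn R 1))).
have := HK n Kn; rewrite ltr_pdivrMr//.
have := e2 n mn; lra.
Unshelve. all: by end_near. Qed.

Lemma fact_growthZ (R : comPzRingType) d (x rho : R) n :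
  fact_growth d (x * rho) n = x ^+ n * fact_growth d rho n.
Proof. by rewrite /fact_growth exprMn mulrA. Qed.

Lemma ler_fact_growth (R : realFieldType) d (rho sigma : R) n :
  0 <= rho -> rho <= sigma -> fact_growth d rho n <= fact_growth d sigma n.
Proof.
move=> r0 rs; rewrite ler_wpM2r ?exprn_ge0//.
by rewrite lerXn2r ?nnegrE// (le_trans r0).
Qed.

(** The ratio of the two sequences is at least [2 ^+ n], which eventually exceeds [C / c]. *)
Lemma fact_growth_incomparable (R : realType) d (rho sigma c C : R) m :
  0 < rho -> 2 * rho <= sigma -> 0 < c ->
  (forall n, (m <= n)%N -> c * fact_growth d sigma n <= C * fact_growth d rho n) ->
  False.
Proof.
move=> r0 rs c0 H; have [K HK] := exp2_unbounded (C / c).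
have /= := HK (maxn m K) (leq_maxr _ _).
rewrite ltNge ler_pdivlMr// => /negP; apply.
rewrite -(ler_pM2r (fact_growth_gt0 d (maxn m K) r0)).
rewrite (le_trans _ (H _ (leq_maxl _ _)))// mulrAC -fact_growthZ mulrC.
by rewrite ler_wpM2l ?(ltW c0)// ler_fact_growth// mulr_ge0// ltW.
Qed.

(** * Growth of solutions from bounds on the coefficients *)

Section Growth.
Variables (R : realType) (a b : nat -> R) (d N : nat) (kappa D : R).
Hypotheses (N_gt0 : (0 < N)%N) (kappa_gt0 : 0 < kappa) (D_gt0 : 0 < D).
Hypothesis a_lower : forall n, (N <= n)%N -> kappa * n%:R ^+ d <= 2 * `|a n|.
Hypothesis b_upper : forall n, (N <= n)%N -> `|b n| <= D * n%:R ^+ (2 * d).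

Let natr_gt0 n : (N <= n)%N -> 0 < n%:R ^+ d :> R.
Proof. by move=> Nn; rewrite exprn_gt0// ltr0n (leq_trans N_gt0). Qed.

Let natrS_le n : (N <= n)%N -> n.+1%:R ^+ d <= 2 ^+ d * n%:R ^+ d :> R.
Proof.
move=> Nn; rewrite -exprMn lerXn2r ?nnegrE ?mulr_ge0//.
by rewrite -natrM ler_nat; have := leq_trans N_gt0 Nn; lia.
Qed.

Lemma growth_neq0 n : (N <= n)%N -> a n != 0.
Proof.
move=> Nn; rewrite -normr_gt0 -(pmulr_rgt0 _ (ltr0Sn R 1)).
by rewrite (lt_le_trans _ (a_lower Nn))// mulr_gt0// natr_gt0.
Qed.

(** The factor [2 ^+ d] trades one (n+1)^d for n^d, and 32 is 8 times the 4 coming from two uses of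
    [a_lower]. *)
Lemma growth_ratio n : 32 * D * 2 ^+ d <= kappa ^+ 2 -> (N <= n)%N ->
  8 * `|b n.+1| <= `|a n| * `|a n.+1|.
Proof.
move=> kD Nn; have Nn1 : (N <= n.+1)%N by exact: leqW.
have := ler_pM _ _ (a_lower Nn) (a_lower Nn1).
rewrite !mulr_ge0// ?exprn_ge0 ?(ltW kappa_gt0)// => /(_ isT isT).
have := b_upper Nn1; rewrite mul2n -addnn exprD.
have := natrS_le Nn; have := natr_gt0 Nn; have := natr_gt0 Nn1.
set x := n%:R ^+ d; set y := n.+1%:R ^+ d => y0 x0 yx bD aa.
have h1 : D * (y * y) <= D * (2 ^+ d * x * y).
  by rewrite ler_wpM2l ?(ltW D_gt0)// ler_wpM2r// ltW.
have h2 : 32 * D * 2 ^+ d * (x * y) <= kappa ^+ 2 * (x * y).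
  by rewrite ler_wpM2r// ltW// mulr_gt0.
lra.
Qed.

(** Dominance and [a_lower] each lose a factor 2, whence the rate [kappa / 4]. *)
Lemma dominant_growth (u : nat -> R) m : (N <= m)%N -> dominant a u m ->
  exists2 c, 0 < c &
    forall n, (m <= n)%N -> c * fact_growth d (kappa / 4) n <= `|u n|.
Proof.
move=> Nm dom; have k40 : 0 < kappa / 4 by rewrite divr_gt0.
have F0 n := fact_growth_gt0 d n k40.
have mono : forall n, (m <= n)%N ->
    fact_growth d (kappa / 4) n * `|u m| <= fact_growth d (kappa / 4) m * `|u n|.
  apply: (ratio_nondecreasing (x := fun n => `|u n|) F0) => n mn.
  rewrite fact_growthS [leLHS]mulrAC mulrC ler_pM2l ?F0//.
  have [_ un] := dom n mn; have := a_lower (leqW (leq_trans Nm mn)).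
  by move=> /(ler_wpM2r (normr_ge0 (u n))); lra.
exists (`|u m| / fact_growth d (kappa / 4) m).
  by rewrite divr_gt0 ?F0// normr_gt0; have [] := dom m (leqnn m).
by move=> n mn; rewrite mulrAC ler_pdivrMr ?F0// mulrC [leRHS]mulrC mono.
Qed.

(** Each step multiplies [s] by at most 4 D (n+2)^d / kappa, and (n+2)^d is at most 2^d (n+1)^d.
    Here [s] need not solve the recurrence; it will be an error term. *)
Lemma subdominant_growth (s : nat -> R) m : (N <= m)%N ->
  (forall n, (m <= n)%N -> 0 <= s n) -> subdominant a b s m ->
  exists2 C, 0 <= C & forall n, (m <= n)%N ->
    s n <= C * fact_growth d (4 * D * 2 ^+ d / kappa) n.
Proof.
move=> Nm s0 sub; set rho := 4 * D * 2 ^+ d / kappa.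
have rho0 : 0 < rho by rewrite divr_gt0// !mulr_gt0// exprn_gt0.
have F0 n := fact_growth_gt0 d n rho0.
have mono : forall n, (m <= n)%N ->
    fact_growth d rho n * - s m <= fact_growth d rho m * - s n.
  apply: (ratio_nondecreasing (x := fun n => - s n) F0) => n mn.
  rewrite fact_growthS [leLHS]mulrAC mulrC ler_pM2l ?F0// mulrN lerN2.
  have Nn1 := leqW (leq_trans Nm mn); have Nn2 := leqW Nn1.
  have := sub n mn; rewrite (ger0_norm (s0 _ mn)) (ger0_norm (s0 _ (leqW mn))).
  have := ler_wpM2r (s0 _ (leqW mn)) (a_lower Nn2).
  have := ler_wpM2r (s0 _ mn) (b_upper Nn2).
  rewrite mul2n -addnn exprD; set y := n.+2%:R ^+ d => h1 h2 h3.
  have y0 : 0 < y by exact: natr_gt0.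
  have h4 : kappa * s n.+1 <= 4 * D * y * s n.
    by rewrite -(ler_pM2l y0); lra.
  rewrite /rho -(ler_pM2l kappa_gt0) (le_trans h4)//.
  have -> : kappa * (4 * D * 2 ^+ d / kappa * n.+1%:R ^+ d * s n) =
    4 * D * (2 ^+ d * n.+1%:R ^+ d) * s n by field; rewrite gt_eqF.
  by rewrite ler_wpM2r ?s0// ler_wpM2l ?natrS_le// mulr_ge0// ltW.
exists (s m / fact_growth d rho m); first by rewrite divr_ge0 ?s0// ltW.
move=> n mn; rewrite mulrAC ler_pdivlMr ?F0//.
by have := mono n mn; rewrite !mulrN lerN2; lra.
Qed.

End Growth.

(** * From the limsup rate to bounds on the gcd *)

Lemma limn_esup_lt_eventually (R : realType) (u : nat -> \bar R) (x : \bar R) :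
  (limn_esup u < x)%E -> exists N, forall n, (N <= n)%N -> (u n < x)%E.
Proof.
move=> /ereal_inf_lt[_ [V [N _ NV] <-] ltx]; exists N => n Nn.
by apply: le_lt_trans ltx; apply: ereal_sup_ubound; exists n => //; exact: NV.
Qed.

Lemma lt_limn_esup_frequently (R : realType) (u : nat -> \bar R) (x : \bar R) :
  (x < limn_esup u)%E -> forall N, exists2 n, (N <= n)%N & (x < u n)%E.
Proof.
move=> xu N.
have : (x < ereal_sup (u @` [set n | (N <= n)%N]))%E.
  apply: lt_le_trans xu _; apply: ereal_inf_lbound.
  by exists [set n | (N <= n)%N] => //; exact: nbhs_infty_ge.
by move=> /ereal_sup_gt[_ [n /= Nn <-] xun]; exists n.
Qed.

Section GcdRate.
Variables (R : realType) (d : nat) (a b : {poly int}).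
Let g n : R := (gcdz (pcf_num a b n) (pcf_den a b n))%:~R.

Lemma gcd_rate_lt (c : R) : (gcd_rate R d a b < c%:E)%E ->
  exists N, forall n, (N <= n)%N -> g n <= fact_growth d (expR c) n.
Proof.
move=> /limn_esup_lt_eventually[N HN]; exists (maxn N 1) => n.
rewrite geq_max => /andP[/HN + n0].
have F0 := fact_growth_gt0 d n (expR_gt0 c).
have fn0 : 0 < n`!%:R ^+ d :> R by rewrite exprn_gt0// ltr0n fact_gt0.
have n0R : 0 < n%:R :> R by rewrite ltr0n.
have := ler0z R (gcdz (pcf_num a b n) (pcf_den a b n)).
rewrite -/(g n) lez_nat leq0n le_eqVlt => /predU1P[<- _|g0]; first exact: ltW.
have x0 : 0 < g n / n`!%:R ^+ d by rewrite divr_gt0.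
rewrite lne_EFin// -EFinM lte_fin mulrC ltr_pdivrMr// => h.
rewrite -ler_pdivrMr// -expRM_natr -[leLHS]lnK// ler_expR; exact: ltW.
Qed.

Lemma lt_gcd_rate (c : R) : (c%:E < gcd_rate R d a b)%E ->
  forall N, exists2 n, (N <= n)%N & 0 < g n /\ fact_growth d (expR c) n <= g n.
Proof.
move=> /lt_limn_esup_frequently H N; have [n + hn] := H (maxn N 1).
rewrite geq_max => /andP[Nn n0]; exists n => //.
have fn0 : 0 < n`!%:R ^+ d :> R by rewrite exprn_gt0// ltr0n fact_gt0.
have n0R : 0 < n%:R :> R by rewrite ltr0n.
have := ler0z R (gcdz (pcf_num a b n) (pcf_den a b n)).
rewrite -/(g n) lez_nat leq0n le_eqVlt => /predU1P[g0|g0].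
  (* A zero gcd contributes [-oo], which cannot exceed [c]; hence the gcd found is positive. *)
  move: hn; rewrite -/(g n) -g0 mul0r le0_lneNy// gt0_muleNy ?lte_fin ?invr_gt0//.
have x0 : 0 < g n / n`!%:R ^+ d by rewrite divr_gt0.
split=> //; move: hn; rewrite lne_EFin// -EFinM lte_fin mulrC ltr_pdivlMr// => h.
rewrite -ler_pdivlMr// -expRM_natr -[leRHS]lnK// ler_expR; exact: ltW.
Qed.

End GcdRate.

(** * Convergence of p/q when q is dominant *)

Section Convergence.
Variables (R : realType) (a b : nat -> R) (N : nat).
Hypothesis a_neq0 : forall n, (N <= n)%N -> a n != 0.
Hypothesis ab : forall n, (N <= n)%N -> 8 * `|b n.+1| <= `|a n| * `|a n.+1|.
Variables (p q : nat -> R) (m : nat).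
Hypotheses (p_sol : pcf_solution a b p) (q_sol : pcf_solution a b q).
Hypotheses (Nm : (N <= m)%N) (q_dom : dominant a q m).

(** When [q n] is nonzero, this is [|q n|] times the distance between convergents [n] and [n.+1]. *)
Let s n := `|casoratian p q n| / `|q n.+1|.

Let s_ge0 n : 0 <= s n. Proof. exact: divr_ge0. Qed.

(** The Casoratian gains the factor [- b n.+2], while dominance bounds [|a n.+2| * |q n.+1|] by
    [2 * |q n.+2|]. *)
Lemma casoratian_subdominant : subdominant a b s m.
Proof.
move=> n mn; have [q1 h] := q_dom (leqW mn).
have [q2 _] := q_dom (leqW (leqW mn)).
have Q2 : 0 < `|q n.+2| by rewrite normr_gt0.
have Q1 : 0 < `|q n.+1| by rewrite normr_gt0.
rewrite (ger0_norm (s_ge0 _)) (ger0_norm (s_ge0 _)) /s.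
rewrite (casoratianS p_sol q_sol) normrM normrN.
rewrite !mulrA ler_pdivrMr// [leRHS]mulrAC ler_pdivlMr//.
rewrite [leLHS](_ : _ = `|b n.+2| * `|casoratian p q n| *
  (`|a n.+2| * `|q n.+1|)); last by ring.
rewrite [leRHS](_ : _ = `|b n.+2| * `|casoratian p q n| * (2 * `|q n.+2|)).
  by rewrite ler_wpM2l// mulr_ge0.
by ring.
Qed.

Lemma dominant_cvg : exists2 L : R, (fun n => p n / q n) @ \oo --> L &
  forall n, (m <= n)%N -> `|L * q n - p n| <= 2 * s n.
Proof.
have q0 n : (m <= n)%N -> 0 < `|q n|.
  by move=> /q_dom[]; rewrite normr_gt0.
pose e n := s n / `|q n|.
have [n mn|n mn|L pqL Le] :=
  @geometric_steps_cvg R (fun n => p n / q n) e m.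
- have Q0 := q0 n mn; have Q1 := q0 n.+1 (leqW mn).
  rewrite /e /s -!normrV ?unitfE -?normr_gt0// -!normrM le_eqVlt; apply/orP; left.
  apply/eqP; congr `|_|; rewrite /casoratian.
  by field; rewrite -!normr_gt0 Q0 Q1.
- have Q0 := q0 n mn; have Q1 := q0 n.+1 (leqW mn).
  rewrite /e mulrA ler_pdivrMr// [leRHS]mulrAC ler_pdivlMr//.
  have := casoratian_subdominant mn.
  rewrite (ger0_norm (s_ge0 _)) (ger0_norm (s_ge0 _)) => h1.
  have [_ h2] := q_dom mn.
  have Nn1 := leqW (leq_trans Nm mn); have h3 := ab Nn1.
  have A1 : 0 < `|a n.+1| by rewrite normr_gt0 a_neq0.
  have A2 : 0 < `|a n.+2| by rewrite normr_gt0 a_neq0// leqW.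
  (* The two inequalities together cost a factor 4, so the 8 in [ab] leaves exactly the halving of
     [e]. *)
  have h12 := ler_pM (mulr_ge0 (ltW A2) (s_ge0 n.+1))
    (mulr_ge0 (ltW A1) (ltW Q0)) h1 h2.
  have h4 := ler_wpM2r (mulr_ge0 (s_ge0 n) (ltW Q1)) h3.
  by rewrite -(ler_pM2l (mulr_gt0 A1 A2)); lra.
exists L => // n mn; have Q0 := q0 n mn.
have := Le n mn; rewrite /e mulrA ler_pdivlMr// -normrM.
by rewrite mulrBl divfK// -normr_gt0.
Qed.

End Convergence.

(** * Irrationality of the limit for one parameter value *)

Section Irrationality.
Variables (R : realType) (a b : nat -> R) (d N : nat) (kappa D lo hi : R).
Hypotheses (N_gt0 : (0 < N)%N) (kappa_gt0 : 0 < kappa) (D_gt0 : 0 < D).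
Hypothesis a_lower : forall n, (N <= n)%N -> kappa * n%:R ^+ d <= 2 * `|a n|.
Hypothesis b_upper : forall n, (N <= n)%N -> `|b n| <= D * n%:R ^+ (2 * d).
Hypothesis kappaD : 32 * D * 2 ^+ d <= kappa ^+ 2.
Hypotheses (hi_gt0 : 0 < hi) (kappa_hi : 8 * hi <= kappa).
Hypotheses (lo_gt0 : 0 < lo) (kappa_lo : 8 * D * 2 ^+ d <= kappa * lo).

(** [kappa_hi] makes the dominant rate [kappa / 4] at least twice the gcd rate [hi]. *)
Lemma dominant_not_eventually_le_gcd (u g : nat -> R) (C : R) m :
  (N <= m)%N -> dominant a u m -> 0 <= C ->
  (exists n0, forall n, (n0 <= n)%N -> `|u n| <= C * g n) ->
  (exists n0, forall n, (n0 <= n)%N -> g n <= fact_growth d hi n) -> False.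
Proof.
move=> Nm dom C0 [n0 ug] [n1 gF].
have [c c0 cu] := dominant_growth kappa_gt0 a_lower Nm dom.
apply: (@fact_growth_incomparable R d hi (kappa / 4) c C (maxn m (maxn n0 n1))) => //.
  by rewrite ler_pdivlMr//; have := kappa_hi; lra.
move=> n; rewrite !geq_max => /and3P[mn n0n n1n].
rewrite (le_trans (cu n mn))// (le_trans (ug n n0n))//.
by rewrite ler_wpM2l// gF.
Qed.

Variables (p q : nat -> int).
Let pR n : R := (p n)%:~R.
Let qR n : R := (q n)%:~R.
Let g n : R := (gcdz (p n) (q n))%:~R.
Hypotheses (p_sol : pcf_solution a b pR) (q_sol : pcf_solution a b qR).
Hypothesis g_upper :
  exists n0, forall n, (n0 <= n)%N -> g n <= fact_growth d hi n.
Hypothesis g_lower : forall n0, exists2 n, (n0 <= n)%N &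
  0 < g n /\ fact_growth d lo n <= g n.

(** Proportionality makes [q n] divide [Q] times the gcd, so [q] would be dominant yet bounded by
    the gcd. *)
Lemma eventually_proportional_absurd (P Q : int) m n1 : Q != 0 ->
  (N <= m)%N -> dominant a qR m ->
  (forall n, (n1 <= n)%N -> P * q n = Q * p n) -> False.
Proof.
move=> Q0 Nm dom pq.
apply: (@dominant_not_eventually_le_gcd qR g `|Q|%:~R m) => //.
exists (maxn m n1) => n; rewrite geq_max => /andP[/dom[qn0 _] /pq pqn].
have q0 : q n != 0 by apply: contraNneq qn0; rewrite /qR => ->.
have : (q n %| Q * gcdz (p n) (q n))%Z.
  have : (q n %| gcdz (Q * p n) (Q * q n))%Z.
    by rewrite dvdz_gcd -pqn dvdz_mull ?dvdzz// dvdz_mull ?dvdzz.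
  by rewrite -mulz_gcdr !dvdzE !abszM absz_nat.
rewrite dvdzE => /dvdn_leq; rewrite abszM muln_gt0 !absz_gt0 Q0/=.
have g0 : gcdz (p n) (q n) != 0 by rewrite gcdz_eq0 (negbTE q0) andbF.
rewrite g0 => /(_ isT) h.
by rewrite /qR /g -intr_norm -intrM ler_int -!abszE -PoszM lez_nat.
Qed.

Lemma dominant_irrational m : (N <= m)%N -> dominant a qR m ->
  exists2 L : R, (fun n => pR n / qR n) @ \oo --> L & irrational L.
Proof.
move=> Nm dom.
have a0 := growth_neq0 N_gt0 kappa_gt0 a_lower.
have ab n : (N <= n)%N -> 8 * `|b n.+1| <= `|a n| * `|a n.+1|.
  exact: (growth_ratio N_gt0 kappa_gt0 D_gt0 a_lower b_upper).
have [L pqL Lq] := dominant_cvg a0 ab p_sol q_sol Nm dom.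
exists L => // -[r _ rL].
have sub := casoratian_subdominant p_sol q_sol dom.
have [|C C0 sC] := subdominant_growth N_gt0 kappa_gt0 D_gt0 a_lower b_upper Nm _ sub.
  by move=> n _; exact: divr_ge0.
set rho := 4 * D * 2 ^+ d / kappa in sC.
have rho0 : 0 < rho by rewrite divr_gt0// !mulr_gt0// exprn_gt0.
have rholo : 2 * rho <= lo.
  by rewrite /rho mulrA ler_pdivrMr//; have := kappa_lo; lra.
pose P := numq r; pose Q := denq r.
have Q0 : Q != 0 by exact: denq_neq0.
have QR : 0 < Q%:~R :> R by rewrite ltr0z denq_gt0.
have LE : P%:~R = Q%:~R * L by rewrite -rL /ratr mulrC divfK// gt_eqF.
pose z n := P * q n - Q * p n.
have zE n : (z n)%:~R = Q%:~R * (L * qR n - pR n).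
  by rewrite /z intrB !intrM LE; rewrite /pR /qR; ring.
have z_small n0 : exists2 n, (n0 <= n)%N & z n = 0.
  (* Past [K], the constant in the bound on [z] is absorbed by [2 ^+ n], and [2 * rho <= lo] puts
     [|z n|] below the gcd that divides it. *)
  have [K HK] := exp2_unbounded (2 * Q%:~R * C).
  have [n] := g_lower (maxn n0 (maxn K m)).
  rewrite !geq_max => /and3P[n0n Kn mn] [gn0 gn]; exists n => //.
  apply/eqP/negPn/negP => zn0.
  have : (gcdz (p n) (q n) %| z n)%Z.
    by apply: rpredB; apply: dvdz_mull; [exact: dvdz_gcdr|exact: dvdz_gcdl].
  rewrite dvdzE => /dvdn_leq; rewrite absz_gt0 zn0 => /(_ isT) gz.
  have : g n <= `|(z n)%:~R| by rewrite -intr_norm ler_int; lia.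
  apply/negP; rewrite -ltNge (lt_le_trans _ gn)// zE normrM (gtr0_norm QR).
  have F0 := fact_growth_gt0 d n rho0.
  have h1 : fact_growth d (2 * rho) n <= fact_growth d lo n.
    by rewrite ler_fact_growth// mulr_ge0// ltW.
  rewrite (lt_le_trans _ h1)// fact_growthZ.
  have h2 : 2 * Q%:~R * C * fact_growth d rho n < 2 ^+ n * fact_growth d rho n.
    by rewrite ltr_pM2r ?HK.
  rewrite (le_lt_trans _ h2)// -!mulrA mulrCA ler_pM2l// (le_trans (Lq n mn))//.
  by rewrite ler_wpM2l// sC.
have z_sol : pcf_solution a b (fun n => (z n)%:~R).
  by move=> n; rewrite !zE p_sol q_sol; ring.
case: (solution_dichotomy a0 ab z_sol) => [zsub|[n1 Nn1 zdom]]; last first.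
  have [n nn1 zn0] := z_small n1.
  by have [] := zdom n nn1; rewrite zn0 eqxx.
(* Once a subdominant solution vanishes it stays zero, because [a] does not vanish. *)
have [n2 Nn2 zn2] := z_small N.
apply: (@eventually_proportional_absurd P Q m n2 Q0 Nm dom) => n n2n.
apply/eqP; rewrite -subr_eq0; apply/eqP; rewrite -/(z n).
elim: n n2n => [|n IH]; first by rewrite leqn0 => /eqP n20; rewrite -n20.
rewrite leq_eqVlt => /predU1P[<-//|n2n].
have Nn := leq_trans Nn2 n2n; have := zsub n Nn.
rewrite (IH n2n) normr0 mulr0 pmulr_rle0 ?normr_gt0 ?a0 ?normr_le0 ?intr_eq0//.
  by move/eqP.
by rewrite !leqW.
Qed.

End Irrationality.

(** * Numerators and denominators as polynomials in k *)

Lemma pcf_recS (a b : {poly int}) init n :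
  pcf_rec a b init n.+1 = ((pcf_rec a b init n).2,
    a.[n.+1%:Z] * (pcf_rec a b init n).2 + b.[n.+1%:Z] * (pcf_rec a b init n).1).
Proof. by rewrite /=; case: (pcf_rec a b init n). Qed.

Lemma pcf_rec_solution (R : realType) (a b : {poly int}) init :
  pcf_solution (fun n => a.[n%:Z]%:~R : R) (fun n => b.[n%:Z]%:~R)
    (fun n => (pcf_rec a b init n).2%:~R).
Proof. by move=> n; rewrite 2!pcf_recS/= intrD !intrM. Qed.

(* The recurrence for PCF[k a, b] with k replaced by the indeterminate 'X. *)
Fixpoint pcf_rec_poly (a b : {poly int}) (init : {poly int} * {poly int})
    (n : nat) : {poly int} * {poly int} :=
  if n is m.+1 then
    let: (x, y) := pcf_rec_poly a b init m in
    (y, a.[n%:Z] *: ('X * y) + b.[n%:Z] *: x)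
  else init.

Lemma pcf_rec_poly_horner (a b : {poly int}) init (k : int) n :
  pcf_rec (k *: a) b (init.1.[k], init.2.[k]) n =
  ((pcf_rec_poly a b init n).1.[k], (pcf_rec_poly a b init n).2.[k]).
Proof.
elim: n => [//|n IH]; rewrite pcf_recS IH /=.
case: (pcf_rec_poly a b init n) => x y /=; congr (_, _).
by rewrite hornerD !hornerZ hornerM hornerX mulrCA mulrA.
Qed.

(** * The larger root and the size of 1 - delta *)

Lemma larger_root_ge (R : realType) (A B : int) (alpha : R) :
  larger_root A B alpha -> `|A%:~R| <= 2 * `|alpha|.
Proof.
move=> [root_alpha larger].
(* The other root is [A - alpha]. *)
have := larger (A%:~R - alpha); have := ler_normD (A%:~R - alpha) alpha.
rewrite subrK => h1 h2.
have : `|A%:~R - alpha| <= `|alpha|.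
  by apply: h2; rewrite sqrrB root_alpha; ring.
lra.
Qed.

(** Here [x], [l], [beta] stand for the logarithms of |alpha|, lambda, |B|. The difference is
    [(beta - 2 * l) / (x - l)], with bounded numerator. *)
Lemma delta_near1 (R : realFieldType) (x l beta M eps : R) : 0 < eps ->
  `|l| <= M -> M + (2 * M + `|beta|) / eps + 1 <= x ->
  `|1 - (x - beta + l) / (x - l)| < eps.
Proof.
move=> eps0 lM xT; have M0 : 0 <= M := le_trans (normr_ge0 l) lM.
have T0 : 0 <= (2 * M + `|beta|) / eps.
  by rewrite divr_ge0 ?addr_ge0 ?mulr_ge0// ltW.
have xl : (2 * M + `|beta|) / eps < x - l.
  by have := ler_norm l; lra.
have xl0 : 0 < x - l by exact: le_lt_trans T0 xl.
rewrite (_ : 1 - _ = (beta - 2 * l) / (x - l)); last by field; rewrite gt_eqF.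
rewrite normrM normfV (gtr0_norm xl0) ltr_pdivrMr//.
have := xl; rewrite ltr_pdivrMr// [_ * eps]mulrC => /(le_lt_trans _); apply.
by rewrite (le_trans (ler_normB _ _))// normrM ger0_norm//; lra.
Qed.

(** * Bounds uniform in k and the degree descent *)

Section LargeParameter.
Variables (R : realType) (a1 b : {poly int}) (d : nat).
Hypotheses (size_a1 : size a1 = d.+1) (size_b : size b = (2 * d).+1).

Let aR (k n : nat) : R := (k%:Z *: a1).[n%:Z]%:~R.
Let bR (n : nat) : R := b.[n%:Z]%:~R.

(** [N] and [D] serve all [k] at once, since [k] only scales [a1]; the descent on degrees in [k]
    relies on this. *)
Lemma pcf_coef_bounds : exists N : nat, exists D : nat,
  [/\ (0 < N)%N, (0 < D)%N,
    forall k n, (N <= n)%N -> k%:R * n%:R ^+ d <= 2 * `|aR k n|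
  & forall n, (N <= n)%N -> `|bR n| <= D%:R * n%:R ^+ (2 * d)].
Proof.
have a0 : a1 != 0 by rewrite -size_poly_eq0 size_a1.
have [X lowa] := exp_le_normr_horner a0.
pose D : int := \sum_(i < size b) `|b`_i|.
have D0 : 0 <= D by exact: sumr_ge0.
exists X.+1, (absz D).+1; split=> // [k n Xn|n Xn].
  have := lowa n (ltnW Xn); rewrite size_a1/= -(ler_int R) rmorphXn/= intrM.
  rewrite intr_norm /aR hornerZ intrM normrM normr_nat => h.
  by rewrite mulrCA ler_wpM2l.
have n1 : 1 <= n%:Z by lia.
have := normr_horner_le b n1; rewrite -/D size_b/= -(ler_int R) intr_norm.
move=> /le_trans; apply; rewrite intrM rmorphXn/= ler_wpM2r ?exprn_ge0//.
by rewrite -[leRHS]/((absz D).+1%:Z%:~R) ler_int; lia.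
Qed.

Lemma eventually_zero_of_not_dominant (init : {poly int} * {poly int}) N D :
  (0 < N)%N ->
  (forall k n, (N <= n)%N -> k%:R * n%:R ^+ d <= 2 * `|aR k n|) ->
  (forall n, (N <= n)%N -> `|bR n| <= D%:R * n%:R ^+ (2 * d)) ->
  (0 < D)%N ->
  (forall K : nat, exists2 k : nat, (K <= k)%N &
    forall m, (N <= m)%N -> ~ dominant (aR k)
      (fun n => (pcf_rec_poly a1 b init n).2.[k%:Z]%:~R) m) ->
  exists n1, forall n, (n1 <= n)%N -> (pcf_rec_poly a1 b init n).2 = 0.
Proof.
move=> N0 a_lower b_upper D0 notdom.
(* Subdominance with the two coefficient bounds gives k |u_(n+1)| <= 4 D (n+2)^d |u_n|, with a
   constant free of [k]. *)
apply: (eventually_zero_of_small_values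
  (C := fun n => (4 * D * n.+2 ^ d)%N%:Z) (N := N)) => K.
have [k] := notdom (maxn K (32 * D * 2 ^ d)%N).
rewrite geq_max => /andP[Kk Dk] ndom; exists k => // n Nn.
have k1 : (0 < k)%N by apply: leq_trans Dk; rewrite !muln_gt0 expn_gt0 D0.
have k0R : 0 < k%:R :> R by rewrite ltr0n.
have D0R : 0 < D%:R :> R by rewrite ltr0n.
have kD : 32 * D%:R * 2 ^+ d <= k%:R ^+ 2 :> R.
  rewrite -natrX -!natrM -natrX ler_nat (leq_trans Dk)//.
  by rewrite expnS expn1 leq_pmull.
have sol : pcf_solution (aR k) bR
    (fun n => (pcf_rec_poly a1 b init n).2.[k%:Z]%:~R).
  move=> i; have := pcf_rec_solution R (k%:Z *: a1) b
    (init.1.[k%:Z], init.2.[k%:Z]) i.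
  by rewrite !pcf_rec_poly_horner.
case: (solution_dichotomy (growth_neq0 N0 k0R (a_lower k)) _ sol) => [n' N'|sub|].
- exact: (growth_ratio N0 k0R D0R (a_lower k) b_upper).
- have Nn2 : (N <= n.+2)%N by rewrite !leqW.
  have := sub n Nn.
  set u := _.[_]; set v := _.[_] => h.
  have y0 : 0 < n.+2%:R ^+ d :> R by rewrite exprn_gt0.
  rewrite -(ler_int R) !intrM !intr_norm -(ler_pM2l y0).
  have := ler_wpM2r (normr_ge0 (u%:~R : R)) (a_lower k _ Nn2).
  have := ler_wpM2r (normr_ge0 (v%:~R : R)) (b_upper _ Nn2).
  rewrite mul2n -addnn exprD -!pmulrn !natrM natrX.
  lra.
- by move=> [m Nm /(_ _)] dom; case: (ndom m Nm).
Qed.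

End LargeParameter.

(** The start [a.[0] *: 'X] reflects p_0 = k a(0). *)
Definition pcf_num_poly (a b : {poly int}) (n : nat) : {poly int} :=
  (pcf_rec_poly a b (1, a.[0] *: 'X) n).2.

Definition pcf_den_poly (a b : {poly int}) (n : nat) : {poly int} :=
  (pcf_rec_poly a b (0, 1) n).2.

Lemma pcf_num_polyE (a b : {poly int}) (k : int) n :
  pcf_num (k *: a) b n = (pcf_num_poly a b n).[k].
Proof.
have := pcf_rec_poly_horner a b (1, a.[0] *: 'X) k n.
by rewrite /= hornerC hornerZ hornerX mulrC -hornerZ /pcf_num => ->.
Qed.

Lemma pcf_den_polyE (a b : {poly int}) (k : int) n :
  pcf_den (k *: a) b n = (pcf_den_poly a b n).[k].
Proof.
have := pcf_rec_poly_horner a b (0, 1) k n.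
by rewrite /= horner0 hornerC /pcf_den => ->.
Qed.

(** * Dominance of the denominators for large k *)

Lemma pcf_limit_irrational (R : realType) (b a1 : {poly int}) (d : nat)
    (K : nat) (M : R) :
  size a1 = d.+1 -> size b = (2 * d).+1 ->
  (forall k : nat, (K <= k)%N ->
    (- M)%:E < gcd_rate R d (k%:Z *: a1) b /\
    gcd_rate R d (k%:Z *: a1) b < M%:E)%E ->
  exists K' : nat, forall k : nat, (K' <= k)%N ->
    exists2 L : R, pcf_convergent R (k%:Z *: a1) b @ \oo --> L & irrational L.
Proof.
move=> size_a1 size_b rate.
have [N [D [N0 D0 a_lower b_upper]]] := pcf_coef_bounds R size_a1 size_b.
pose aR (k n : nat) : R := (k%:Z *: a1).[n%:Z]%:~R.
pose pR (k n : nat) : R := (pcf_num (k%:Z *: a1) b n)%:~R.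
pose qR (k n : nat) : R := (pcf_den (k%:Z *: a1) b n)%:~R.
have D0R : 0 < D%:R :> R by rewrite ltr0n.
pose lo := expR (- M); pose hi := expR M.
(* The sum of the thresholds for all the conditions in [large]; the final 1 ensures that k is at
   most its square. *)
pose B : R := 32 * D%:R * 2 ^+ d + 8 * hi + 8 * D%:R * 2 ^+ d / lo + 1.
pose K1 := maxn K (Num.bound B).
have large k : (K1 <= k)%N -> [/\ 0 < k%:R :> R,
    32 * D%:R * 2 ^+ d <= k%:R ^+ 2 :> R, 8 * hi <= k%:R
  & 8 * D%:R * 2 ^+ d <= k%:R * lo].
  rewrite geq_max => /andP[_ Bk].
  have lo0 : 0 < lo by exact: expR_gt0.
  have hi0 : 0 < hi by exact: expR_gt0.
  have D2 : 0 < D%:R * 2 ^+ d :> R by rewrite mulr_gt0// exprn_gt0.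
  have Dlo : 0 < 8 * D%:R * 2 ^+ d / lo.
    by rewrite divr_gt0// -mulrA mulr_gt0.
  have B0 : 0 <= B by rewrite /B; lra.
  have kB : B < k%:R by rewrite (lt_le_trans (archi_boundP B0))// ler_nat.
  have k1 : 1 <= k%:R :> R by rewrite /B in kB; lra.
  split; rewrite /B in kB; [lra| |lra|].
    by rewrite (le_trans _ (ler_eXnr _ k1))//; lra.
  by rewrite -ler_pdivrMr//; lra.
pose dom (u : nat -> nat -> R) k := exists2 m, (N <= m)%N & dominant (aR k) (u k) m.
have gU k : (K1 <= k)%N -> exists n0, forall n, (n0 <= n)%N ->
    (gcdz (pcf_num (k%:Z *: a1) b n) (pcf_den (k%:Z *: a1) b n))%:~R
    <= fact_growth d hi n.
  by rewrite geq_max => /andP[/rate[_ /gcd_rate_lt]].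
have gL k : (K1 <= k)%N -> forall n0, exists2 n, (n0 <= n)%N &
    0 < (gcdz (pcf_num (k%:Z *: a1) b n) (pcf_den (k%:Z *: a1) b n))%:~R :> R /\
    fact_growth d lo n <=
      (gcdz (pcf_num (k%:Z *: a1) b n) (pcf_den (k%:Z *: a1) b n))%:~R.
  by rewrite geq_max => /andP[/rate[/lt_gcd_rate + _] _].
have qdom : exists K2, forall k, (K2 <= k)%N -> dom qR k.
  apply: contrapT => /forallNP notq.
  have [nq q0] : exists n1, forall n, (n1 <= n)%N -> pcf_den_poly a1 b n = 0.
    apply: (eventually_zero_of_not_dominant (R := R) N0 a_lower b_upper D0) => K2.
    have /existsNP[k /not_implyP[K2k ndom]] := notq K2.
    exists k => // m Nm domk; apply: ndom; exists m => // n mn.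
    by rewrite /qR !pcf_den_polyE; exact: domk.
  (* With [q] eventually zero the gcd is [|p|]: too large if [p] is dominant for a single such [k],
     and eventually zero if for none. *)
  have [[k K1k [m Nm pdom]]|notp] := pselect (exists2 k, (K1 <= k)%N & dom pR k).
    have [k0 k1 k2 k3] := large k K1k.
    apply: (@dominant_not_eventually_le_gcd R (aR k) d N k%:R hi k0
      (a_lower k) (expR_gt0 _) k2 (pR k) _ 1 m Nm pdom ler01 _ (gU k K1k)).
    exists nq => n nqn; rewrite mul1r pcf_den_polyE q0// horner0 gcdz0.
    by rewrite /pR -intr_norm.
  have [np p0] : exists n1, forall n, (n1 <= n)%N -> pcf_num_poly a1 b n = 0.
    apply: (eventually_zero_of_not_dominant (R := R) N0 a_lower b_upper D0) => K2.
    exists (maxn K1 K2) => [|m Nm domk]; first exact: leq_maxr.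
    apply: notp; exists (maxn K1 K2); first exact: leq_maxl.
    by exists m => // n mn; rewrite /pR !pcf_num_polyE; exact: domk.
  have [n] := gL K1 (leqnn _) (maxn np nq).
  rewrite geq_max => /andP[npn nqn] [].
  by rewrite pcf_num_polyE pcf_den_polyE p0// q0// !horner0 gcd0z ltxx.
have [K2 HK2] := qdom.
exists (maxn K1 K2) => k; rewrite geq_max => /andP[K1k /HK2[m Nm domq]].
have [k0 k1 k2 k3] := large k K1k.
exact: (dominant_irrational N0 k0 D0R (a_lower k) b_upper k1 (expR_gt0 _) k2
  (expR_gt0 _) k3 (pcf_rec_solution _ _ _ _) (pcf_rec_solution _ _ _ _)
  (gU k K1k) (gL k K1k) Nm domq).
Qed.

(** * The limit of delta_k and its consequences *)

Theorem theorem3 (R : realType) (b a1 : {poly int}) (d : nat)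
  (hd : (1 <= d)%N)
  (deg_a1 : size a1 = d.+1) (deg_b : size b = (2 * d).+1)
  (alpha lambda : int -> R) (K : int)
  (h_reduction : forall k : int, K <= k -> factorial_reduction R (k *: a1) b)
  (h_discr : forall k : int, K <= k ->
    - ((lead_coef (k *: a1))%:~R ^+ 2 / 4) < (lead_coef b)%:~R :> R)
  (h_alpha : forall k : int, K <= k ->
    larger_root (lead_coef (k *: a1)) (lead_coef b) (alpha k))
  (h_lambda_gt0 : forall k : int, K <= k -> 0 < lambda k)
  (h_lambda : forall k : int, K <= k ->
    (ln (lambda k))%:E = gcd_rate R d (k *: a1) b)
  (h_bounded : exists M : R, forall k : int, K <= k -> `|ln (lambda k)| <= M) :
  let delta (k : int) : R := pcf_delta (lead_coef b) (alpha k) (lambda k) in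
  (fun k : nat => delta k%:Z) @ \oo --> (1 : R) /\
  exists K' : int, forall k : int, K' <= k ->
    0 < delta k /\
    exists2 L : R, pcf_convergent R (k *: a1) b @ \oo --> L & irrational L.
Proof.
have [M hM] := h_bounded; move=> delta.
have lc0 : lead_coef a1 != 0 by rewrite lead_coef_eq0 -size_poly_eq0 deg_a1.
have delta1 (eps : R) : 0 < eps ->
    exists K' : nat, forall k : nat, (K' <= k)%N -> `|1 - delta k%:Z| < eps.
  move=> eps0.
  pose beta := ln `|(lead_coef b)%:~R : R|.
  pose T := M + (2 * M + `|beta|) / eps + 1.
  (* The factor 2 is there because [|alpha|] is at least half of the leading coefficient of k a1,
     itself at least [k] in absolute value. *)
  exists (maxn (absz K) (Num.bound (2 * expR T))) => k.
  rewrite geq_max => /andP[Kk Tk]; have Kkz : K <= k%:Z by lia.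
  have T0 : 0 <= 2 * expR T by rewrite mulr_ge0// expR_ge0.
  have kT : 2 * expR T < k%:R.
    by rewrite (lt_le_trans (archi_boundP T0))// ler_nat.
  have kA : k%:R <= `|(lead_coef (k%:Z *: a1))%:~R| :> R.
    rewrite lead_coefZ -intr_norm -[leLHS]/(k%:Z%:~R) ler_int normrM.
    by rewrite ger0_norm// ler_peMr// -gtz0_ge1 normr_gt0.
  have := larger_root_ge (h_alpha _ Kkz) => Aa.
  have Ta : expR T <= `|alpha k%:Z| by lra.
  apply: (delta_near1 eps0 (hM _ Kkz)); rewrite -/beta -/T.
  by rewrite -ler_expR lnK// posrE (lt_le_trans (expR_gt0 T)).
(* [M + 1] makes the bounds on the rate strict. *)
have [|K1 HK1] := @pcf_limit_irrational R b a1 d (absz K) (M + 1) deg_a1 deg_b.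
  move=> k Kk; have Kkz : K <= k%:Z by lia.
  have := hM _ Kkz; rewrite -h_lambda// !lte_fin ler_norml => /andP[]; lra.
have [K2 HK2] := delta1 1 ltr01.
split.
  apply/cvgrPdist_lt => eps /delta1[K' HK'].
  by exists K' => // k /= K'k; exact: HK'.
exists (maxn K1 K2)%:Z => -[k|k] //; rewrite lez_nat geq_max => /andP[K1k K2k].
split; last exact: HK1.
by have := HK2 k K2k; rewrite ltr_norml; lra.
Qed.
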